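(* Assume that the PDE $\partial_tu+\nabla\cdot(\mathbf q(u;\boldsymbol\theta_q))=r(u;\boldsymbol\theta_r)$, $\mathbf x\in\Omega$, $t>0$, is linear. Let $F^1_{u(\mathbf x,t)}$ and $F^2_{u(\mathbf x,t)}$ be two families of CDFs (with finite first moments) that solve the CDF equation $$\frac{\partial F}{\partial t}+\dot{\mathbf q}(U;\boldsymbol\theta_q)\cdot\nabla F+r(U;\boldsymbol\theta_r)\frac{\partial F}{\partial U}=0,\qquad (U,\mathbf x)\in\mathbb R\times\Omega,$$ with initial data $F^1_{u_0(\mathbf x)},F^2_{u_0(\mathbf x)}$, $\mathbf x\in\Omega$, and boundary data $F^1_{u_b(\mathbf x,t)},F^2_{u_b(\mathbf x,t)}$, $\mathbf x\in\Gamma$, respectively. Then the 1-Wasserstein discrepancy $$\omega_1(\mathbf x,t)=\int_{\mathbb R}\big|F^1_{u(\mathbf x,t)}(U)-F^2_{u(\mathbf x,t)}(U)\big|\,dU$$ obeys $$\frac{\partial\omega_1}{\partial t}+\dot{\mathbf q}\cdot\nabla\omega_1-\dot r\,\omega_1=0,\quad \mathbf x\in\Omega,\ t>0;\qquad \omega_1(\mathbf x,0)=\omega_0(\mathbf x),\quad\mathbf x\in\Omega;\qquad \omega_1(\mathbf x,t)=\omega_b(\mathbf x,t),\quad\mathbf x\in\Gamma,\ t>0,$$ with $\omega_0(\mathbf x)=\int_{\mathbb R}|F^1_{u_0(\mathbf x)}(U)-F^2_{u_0(\mathbf x)}(U)|\,dU$ and $\omega_b(\mathbf x,t)=\int_{\mathbb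 R}|F^1_{u_b(\mathbf x,t)}(U)-F^2_{u_b(\mathbf x,t)}(U)|\,dU$.
   Context: $\Omega\subset\mathbb R^d$ is a semi-infinite spatial domain with upstream boundary $\Gamma$. The flux $\mathbf q$, source $r$ and their parameters $\boldsymbol\theta_q,\boldsymbol\theta_r$ (possibly depending on $(\mathbf x,t)$) are deterministic, and $\nabla\cdot\mathbf q(U;\boldsymbol\theta_q)=0$ for each fixed value $U$. $\dot{\mathbf q}=\partial\mathbf q/\partial U$, $\dot r=\partial r/\partial U$. ''Linear'' means $\mathbf q$ and $r$ are linear in $u$, so $\dot{\mathbf q}$ and $\dot r$ do not depend on $U$. The unknown $F_{u(\mathbf x,t)}(U)$ of the CDF equation is a function of $(U,\mathbf x,t)$, a CDF in $U$, with data $F_{u_0(\mathbf x)}(U)$ on $\mathbb R\times\Omega$ at $t=0$ and $F_{u_b(\mathbf x,t)}(U)$ on $\mathbb R\times\Gamma$ for $t>0$. Solutions are understood by characteristics. For the CDF equation, the solution is constant along the curves $\frac{d\mathbf x}{dt}=\dot{\mathbf q}$, $\frac{dU}{dt}=r(U;\boldsymbol\theta_r)$ and equals the prescribed datum where the curve starts from the initial or boundary surface. For the equation of $\omega_1$, along the curves $\frac{d\mathbf x}{dt}=\dot{\mathbf q}$ one has $\frac{d\omega_1}{dt}=\dot r\,\omega_1$, with the prescribed value at the starting point. The coefficients are regular enough that each point of the space-time domain lies on exactly one such curve, started from exactly one point of the (noncharacteristic) initial/boundary surface; solutions are considered for all $t\ge0$. *)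

(* Defs.v *)
From HB Require Import structures.
From mathcomp Require Import all_boot all_order all_algebra.
From mathcomp Require Import all_classical all_reals all_analysis.

Set Implicit Arguments.
Unset Strict Implicit.
Unset Printing Implicit Defensive.

Import Order.TTheory GRing.Theory Num.Theory.
Import numFieldNormedType.Exports.

Local Open Scope classical_set_scope.
Local Open Scope ring_scope.

Section geometry.
Context {R : realType} {d : nat}.
Implicit Types (Omega Gamma : set 'rV[R]_d).

(* Omega may or may not contain Gamma: whether the edge Gamma x {0} carries
   initial data depends on this choice (e.g. Omega = [0, +oo[, Gamma = {0}). *)
Definition semi_infinite_domain Omega Gamma : Prop :=
  ~ bounded_set Omega /\ Gamma `<=` closure Omega `\` interior Omega.

Definition inflow_surface Omega Gamma (x : 'rV[R]_d) (t : R) : Prop :=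
  (Omega x /\ t = 0) \/ (Gamma x /\ 0 < t).

Definition spacetime Omega Gamma (x : 'rV[R]_d) (t : R) : Prop :=
  (Omega x /\ 0 <= t) \/ (Gamma x /\ 0 < t).

Definition divergence_free_at (f : 'rV[R]_d -> 'rV[R]_d) (x : 'rV[R]_d) : Prop :=
  (forall i : 'I_d, derivable (fun y => f y 0 i) x (delta_mx 0 i)) /\
  \sum_(i < d) 'D_(delta_mx 0 i) (fun y => f y 0 i) x = 0.

End geometry.

(* Linearity of the PDE: a term independent of the state (a source) is allowed. *)
Definition linear_in_state {R : realType} {W : lmodType R} (f : R -> W) : Prop :=
  exists a b : W, forall U : R, f U = U *: a + b.

(* df/dU (U; th (x, t)), where th is the field of parameters of f. *)
Definition state_derivative {R : realType} {d : nat} {T : Type}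
    {W : normedModType R} (f : R -> T -> W) (th : 'rV[R]_d -> R -> T)
    (U : R) (x : 'rV[R]_d) (t : R) : W :=
  derive1 (fun V : R => f V (th x t)) U.

Definition cdf_finite_mean {R : realType} (F : R -> R) : Prop :=
  exists mu : probability (measurableTypeR R) R,
    (forall U : R, mu `]-oo, U]%classic = (F U)%:E) /\
    mu.-integrable [set: R] (fun U : R => U%:E).

Section characteristics.
Context {R : realType} {d : nat}.
Variables (Omega Gamma : set 'rV[R]_d).

Definition solves_ode {V : normedModType R} (t0 t1 : R) (c v : R -> V) : Prop :=
  {within `[t0, t1], continuous c} /\
  forall t : R, t \in `]t0, t1[ -> is_derive t 1 c (v t).

Definition path_from_inflow (t0 t1 : R) (X : R -> 'rV[R]_d) : Prop :=
  [/\ t0 <= t1, inflow_surface Omega Gamma (X t0) t0 &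
      forall t : R, t \in `[t0, t1] -> spacetime Omega Gamma (X t) t].

(* a x t : velocity *)
Definition space_characteristic (a : 'rV[R]_d -> R -> 'rV[R]_d)
    (t0 t1 : R) (X : R -> 'rV[R]_d) : Prop :=
  path_from_inflow t0 t1 X /\ solves_ode t0 t1 X (fun t => a (X t) t).

(* curves t |-> (U t, X t) in R x Omega *)
Definition cdf_characteristic (qdot : R -> 'rV[R]_d -> R -> 'rV[R]_d)
    (r : R -> 'rV[R]_d -> R -> R) (t0 t1 : R) (c : R -> R * 'rV[R]_d) : Prop :=
  let U t := (c t).1 in
  let X t := (c t).2 in
  [/\ path_from_inflow t0 t1 X,
      solves_ode t0 t1 X (fun t => qdot (U t) (X t) t) &
      solves_ode t0 t1 (U : R -> R^o) (fun t => r (U t) (X t) t)].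

(* Every point of D lies on exactly one curve of the family, started from
   exactly one point. The family is closed under truncation at later times,
   so two members through a common point are only required to have the same
   starting time and to agree as long as both are defined. *)
Definition one_curve_through_each_point {V : Type} (D : V -> R -> Prop)
    (curve : R -> R -> (R -> V) -> Prop) : Prop :=
  (forall (v : V) (t : R), D v t ->
     exists (t0 : R) (c : R -> V), curve t0 t c /\ c t = v) /\
  (forall (s1 t1 : R) (c1 : R -> V) (s2 t2 : R) (c2 : R -> V) (t : R),
     curve s1 t1 c1 -> curve s2 t2 c2 ->
     t \in `[s1, t1] -> t \in `[s2, t2] -> c1 t = c2 t ->
     s1 = s2 /\ forall s : R, s \in `[s1, t1] -> s \in `[s2, t2] -> c1 s = c2 s).

(* dF/dt + qdot . grad F + r dF/dU = 0 with data F0 on R x Omega at t = 0 and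
   Fb on R x Gamma for t > 0. *)
Definition cdf_solution (qdot : R -> 'rV[R]_d -> R -> 'rV[R]_d)
    (r : R -> 'rV[R]_d -> R -> R)
    (F0 : 'rV[R]_d -> R -> R) (Fb : 'rV[R]_d -> R -> R -> R)
    (F : 'rV[R]_d -> R -> R -> R) : Prop :=
  [/\ forall (t0 t1 : R) (c : R -> R * 'rV[R]_d),
        cdf_characteristic qdot r t0 t1 c ->
        forall t : R, t \in `[t0, t1] ->
          F (c t).2 t (c t).1 = F (c t0).2 t0 (c t0).1,
      forall (x : 'rV[R]_d) (U : R), Omega x -> F x 0 U = F0 x U &
      forall (x : 'rV[R]_d) (t U : R), Gamma x -> 0 < t -> F x t U = Fb x t U].

(* dw/dt + a . grad w - k w = 0 with data w0 on Omega at t = 0 and wb on Gamma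
   for t > 0. *)
Definition growth_solution (a : 'rV[R]_d -> R -> 'rV[R]_d)
    (k : 'rV[R]_d -> R -> R) (w0 : 'rV[R]_d -> R) (wb w : 'rV[R]_d -> R -> R)
    : Prop :=
  [/\ forall (t0 t1 : R) (X : R -> 'rV[R]_d),
        space_characteristic a t0 t1 X ->
        solves_ode t0 t1 ((fun t => w (X t) t) : R -> R^o)
          (fun t => k (X t) t * w (X t) t),
      forall x : 'rV[R]_d, Omega x -> w x 0 = w0 x &
      forall (x : 'rV[R]_d) (t : R), Gamma x -> 0 < t -> w x t = wb x t].

End characteristics.

Definition wasserstein1 {R : realType} (F G : R -> R) : R :=
  Rintegral lebesgue_measure [set: R] (fun U => `|F U - G U|).

(* Main.v *)
Require Import Defs.
From HB Require Import structures.
From mathcomp Require Import all_boot all_order all_algebra.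
From mathcomp Require Import all_classical all_reals all_analysis.
From mathcomp Require Import measurable_realfun ring.

Set Implicit Arguments.
Unset Strict Implicit.
Unset Printing Implicit Defensive.

Import Order.TTheory GRing.Theory Num.Theory.
Import numFieldNormedType.Exports.

Local Open Scope classical_set_scope.
Local Open Scope ring_scope.

(** Why the discrepancy obeys a linear transport equation.

Fix a space characteristic X on [t0, t1].  Along it the source is affine in the
state, r = k(t) U + b(t), and the velocity does not depend on U, so the
characteristics of the CDF equation that lie above X are exactly the solutions
of one scalar equation U' = k U + b.  Every state u at time t1 is reached by
such a curve ([cdf_characteristic_above]), and the flow is affine in u:
U_u(t) = B(t) + D(t) u, where D' = k D and D > 0 ([affine_cdf_flow]).  Both CDFs
are constant along these curves, so u |-> F_i(X(t), t, B(t) + D(t) u) is the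
same function at every t.  The substitution U = B(t) + D(t) u then gives

  omega_1(X(t), t) = D(t) * C    with C independent of t,

and omega_1 inherits the equation D' = k D, where k is the derivative of r in
the state.

Nothing is known about k and b as functions of t beyond their appearance in
an ordinary differential equation, so D cannot be written as the exponential of
an integral of k.  Instead D is the difference of two characteristics, ending at
the states 1 and 0.  Distinct characteristics never meet, so D does not vanish,
and it is positive by the intermediate value theorem ([nonvanishing_gt0]).  Any other solution of E' = k E is a multiple of D because
the quotient E / D has zero derivative ([linear_ode_proportional]); this is what
makes the flow affine.  The substitution is proved for measurable integrands
([Rintegral_affine]), since a CDF may jump. *)

(** * Affine substitution in Lebesgue integrals *)

Section affine_substitution.
Context {R : realType}.
Local Notation leb := (@lebesgue_measure R).

Lemma measurable_affine (a k : R) :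
  @measurable_fun _ _ (measurableTypeR R) (measurableTypeR R)
    setT (fun u => a + k * u).
Proof.
by apply: measurable_funD => //; exact: measurable_funM.
Qed.

Lemma preimage_affine_itv (a k x y : R) : 0 < k ->
  (fun u : R => a + k * u) @^-1` `]x, y]%classic =
  `](x - a) / k, (y - a) / k]%classic.
Proof.
move=> k0; apply/seteqP; split => u /=;
  by rewrite !in_itv/= ltr_pdivrMr// ler_pdivlMr// ltrBlDl lerBrDl (mulrC u).
Qed.

(** Both sides are measures in A, and a measure on the line is determined by its
values on the half-open intervals ]x, y]. *)
Lemma lebesgue_measure_affine (a k : R) (A : set R) : 0 < k -> measurable A ->
  leb A = (k%:E * leb ((fun u : R => (a + k * u)%R) @^-1` A))%E.
Proof.
move=> k0 mA.
pose p := [the {measure set (measurableTypeR R) -> \bar R} of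
  pushforward leb (fun u : measurableTypeR R => a + k * u : measurableTypeR R)].
pose mu := mscale (NngNum (ltW k0)) (p (measurable_affine a k)).
rewrite (@lebesgue_measure_unique R mu)//= => _ [[x y]] _ <- /=.
rewrite /mu /mscale /= /pushforward preimage_affine_itv// !lebesgue_measure_itv/=.
rewrite !lte_fin ltr_pM2r ?invr_gt0// ltrD2r; case: ifPn => _; last by rewrite mule0.
rewrite -!EFinB -EFinM; congr EFin.
by rewrite -mulrBl mulrC divfK ?gt_eqF// opprB addrA subrK.
Qed.

(** Lebesgue measure is k times its image under u |-> a + k u, and integrals
against an image measure pull back.  If one of the two integrals is infinite
then so is the other, and both real-valued integrals are 0. *)
Lemma Rintegral_affine (a k : R) (f : R -> R) : 0 < k ->
  measurable_fun [set: R] f -> (forall u, 0 <= f u) ->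
  Rintegral leb [set: R] f =
  k * Rintegral leb [set: R] (fun u => f (a + k * u)).
Proof.
move=> k0 mf f0.
pose p := [the {measure set (measurableTypeR R) -> \bar R} of
  pushforward leb (fun u : measurableTypeR R => a + k * u : measurableTypeR R)].
pose mu := mscale (NngNum (ltW k0)) (p (measurable_affine a k)).
have mfE : @measurable_fun _ _ (measurableTypeR R) _ setT (fun u => (f u)%:E).
  exact/measurable_EFinP.
have -> : Rintegral leb [set: R] f =
    fine (k%:E * \int[leb]_u (f (a + k * u)%R)%:E)%E.
  congr fine; transitivity (\int[mu]_u (f u)%:E)%E.
    by apply: eq_measure_integral => A mA _ /=; exact: lebesgue_measure_affine.
  rewrite ge0_integral_mscale//=; last by move=> u _; rewrite lee_fin.
  rewrite ge0_integral_pushforward//=; first exact: measurable_affine.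
  by move=> u _; rewrite lee_fin.
(* an infinite integral is absorbed by the factor k > 0 and truncates to 0 *)
rewrite /Rintegral.
by case: (integral _ _ _) => [s||] //=;
  rewrite ?gt0_muley ?gt0_muleNy ?lte_fin// mulr0.
Qed.

End affine_substitution.

(** * Linear scalar differential equations without regular coefficients *)

Section ode.
Context {R : realType}.

Lemma solves_ode_eq {V : normedModType R} (t0 t1 : R) (c c' v v' : R -> V) :
  {in `[t0, t1], c =1 c'} -> {in `]t0, t1[, v =1 v'} ->
  solves_ode t0 t1 c v -> solves_ode t0 t1 c' v'.
Proof.
move=> cc' vv' [cc dc]; split.
  by apply: subspace_eq_continuous cc => t; rewrite inE => /cc'.
move=> t tI; rewrite -vv'//; apply: near_eq_is_derive (dc t tI).
near=> s; apply: cc'; apply: subset_itv_oo_cc; near: s.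
exact: near_in_itvoo.
Unshelve. all: by end_near. Qed.

Lemma solves_odeB {V : normedModType R} (t0 t1 : R) (c c' v v' : R -> V) :
  solves_ode t0 t1 c v -> solves_ode t0 t1 c' v' ->
  solves_ode t0 t1 (fun t => c t - c' t) (fun t => v t - v' t).
Proof.
move=> [cc dc] [cc' dc']; split.
  by move=> t; apply: continuousB; [exact: cc|exact: cc'].
by move=> t tI; apply: is_deriveB; [exact: dc|exact: dc'].
Qed.

Lemma solves_odeZ {V : normedModType R} (a t0 t1 : R) (c v : R -> V) :
  solves_ode t0 t1 c v ->
  solves_ode t0 t1 (fun t => a *: c t) (fun t => a *: v t).
Proof.
move=> [cc dc]; split; first by move=> t; apply: continuousZl_tmp; exact: cc.
by move=> t tI; apply: is_deriveZ; exact: dc.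
Qed.

Variables (t0 t1 : R) (k : R -> R).

(** The quotient E / D has derivative (k E D - E k D) / D^2 = 0 in the interior
and is continuous up to the end points, hence constant. *)
Lemma linear_ode_proportional (D E : R -> R) :
  (forall t, t \in `[t0, t1] -> D t != 0) ->
  solves_ode t0 t1 (D : R -> R^o) (fun t => k t * D t) ->
  solves_ode t0 t1 (E : R -> R^o) (fun t => k t * E t) ->
  forall t, t \in `[t0, t1] -> E t = E t1 / D t1 * D t.
Proof.
move=> D0 [cD dD] [cE dE] t tI.
pose g s := E s * (D s)^-1.
have sub s : s \in `[t, t1] -> s \in `[t0, t1].
  by move: tI; rewrite !in_itv/= => /andP[t0t _] /andP[/(le_trans t0t) -> ->].
have cg : {within `[t, t1], continuous g}.
  apply: (@continuous_subspaceW _ _ _ `[t0, t1]) => [s /sub //|].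
  have : {in `[t0, t1]%classic, forall s, D s != 0} by move=> s; rewrite inE => /D0.
  move=> {}D0; rewrite continuous_subspace_in => s sI.
  apply: (@continuousM R (subspace _) E (fun s => (D s)^-1)).
    exact: cE.
  by apply: (@continuousV R (subspace _) D); [exact: D0 | exact: cD].
have dg s : s \in `]t, t1[ -> is_derive s 1 g 0.
  move=> sI.
  have sI' : s \in `]t0, t1[.
    move: tI sI; rewrite !in_itv/= => /andP[t0t _] /andP[ts ->].
    by rewrite (le_lt_trans t0t ts).
  have Ds0 : D s != 0 by apply: D0; apply: subset_itv_oo_cc.
  have dDs : is_derive s 1 D (k s * D s) by exact: dD.
  have dEs : is_derive s 1 E (k s * E s) by exact: dE.
  have dV := is_deriveV Ds0 dDs.
  apply: is_derive_eq; rewrite /GRing.scale/=.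
  by field.
have tt1 : t <= t1 by move: tI; rewrite in_itv/= => /andP[].
have [s _] := MVT_segment tt1 dg cg.
rewrite mul0r => /eqP; rewrite subr_eq0 => /eqP eg.
by rewrite -/(g t1) eg /g divfK// D0.
Qed.

Lemma nonvanishing_gt0 (D : R -> R) :
  {within `[t0, t1], continuous D} ->
  (forall t, t \in `[t0, t1] -> D t != 0) -> 0 < D t1 ->
  forall t, t \in `[t0, t1] -> 0 < D t.
Proof.
move=> cD D0 Dt1 t tI; rewrite ltNge; apply/negP => Dt.
have tt1 : t <= t1 by move: tI; rewrite in_itv/= => /andP[].
have sub s : s \in `[t, t1] -> s \in `[t0, t1].
  by move: tI; rewrite !in_itv/= => /andP[t0t _] /andP[/(le_trans t0t) -> ->].
have cD' : {within `[t, t1], continuous D}.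
  by apply: continuous_subspaceW cD => s /sub.
have [|s sI Ds] := @IVT R D t t1 0 tt1 cD'.
  by rewrite ge_min Dt/= le_max (ltW Dt1) orbT.
by have := D0 s (sub s sI); rewrite Ds eqxx.
Qed.

End ode.

(** * States, CDFs and the Wasserstein discrepancy *)

(** An affine function of the state has its slope as derivative at every state V,
so one V serves for all U. *)
Lemma linear_state_derivative {R : realType} {d : nat} {T : Type}
    {W : normedModType R} (f : R -> T -> W) (th : 'rV[R]_d -> R -> T)
    (x : 'rV[R]_d) (t : R) :
  linear_in_state (f ^~ (th x t)) ->
  exists b : W, forall V U : R, f U (th x t) = U *: state_derivative f th V x t + b.
Proof.
move=> [a [b fE]]; exists b => V U.
suff -> : state_derivative f th V x t = a by exact: fE.
rewrite /state_derivative derive1E.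
have -> : (fun V : R => f V (th x t)) = (fun V : R => V *: a) + cst b.
  by apply/funext => s; rewrite fE.
rewrite deriveD//; last exact/derivable1_diffP/differentiableZl.
rewrite derive_cst addr0.
by rewrite deriveE ?diff_val//= ?scale1r//; exact/differentiableZl.
Qed.

Lemma cdf_nondecreasing {R : realType} (F : R -> R) :
  cdf_finite_mean F -> nondecreasing_fun F.
Proof.
move=> [mu [muF _]] x y xy; rewrite -lee_fin -!muF.
by apply: le_measure; rewrite ?inE//= => u /=; rewrite !in_itv/= => /le_trans; exact.
Qed.

(** Monotone functions are measurable, so the integrand |F - G| may be
substituted although F and G may be discontinuous. *)
Lemma wasserstein1_affine {R : realType} (F G : R -> R) (a k : R) : 0 < k ->
  cdf_finite_mean F -> cdf_finite_mean G ->
  wasserstein1 F G =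
  k * wasserstein1 (fun u => F (a + k * u)) (fun u => G (a + k * u)).
Proof.
move=> k0 cF cG; apply: (@Rintegral_affine _ a k (fun U => `|F U - G U|)) => //.
apply: measurableT_comp => //; apply: measurable_funB;
  apply: nondecreasing_measurable => //; exact: cdf_nondecreasing.
Qed.

(** * Characteristics of the CDF equation above a space characteristic *)

Section linear_characteristics.
Context {R : realType} {d : nat}.
Variables (Omega Gamma : set 'rV[R]_d).
Variables (qdot : R -> 'rV[R]_d -> R -> 'rV[R]_d).
Variables (a : 'rV[R]_d -> R -> 'rV[R]_d).
Variables (r : R -> 'rV[R]_d -> R -> R) (k b : 'rV[R]_d -> R -> R).

Hypothesis qdotE : forall x t, spacetime Omega Gamma x t ->
  forall U, qdot U x t = a x t.
Hypothesis rE : forall x t, spacetime Omega Gamma x t ->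
  forall U, r U x t = U * k x t + b x t.
Hypothesis one_cdf_curve : one_curve_through_each_point
  (fun (p : R * 'rV[R]_d) (t : R) => spacetime Omega Gamma p.2 t)
  (cdf_characteristic Omega Gamma qdot r).
Hypothesis one_space_curve : one_curve_through_each_point
  (spacetime Omega Gamma) (space_characteristic Omega Gamma a).

Variables (t0 t1 : R) (X : R -> 'rV[R]_d).
Hypothesis charX : space_characteristic Omega Gamma a t0 t1 X.

Let le_t01 : t0 <= t1. Proof. by case: charX => -[]. Qed.
Let t1I : t1 \in `[t0, t1]. Proof. by rewrite in_itv/= le_t01 lexx. Qed.
Let t0I : t0 \in `[t0, t1]. Proof. by rewrite in_itv/= le_t01 lexx. Qed.
Let X_spacetime t : t \in `[t0, t1] -> spacetime Omega Gamma (X t) t.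
Proof. by case: charX => -[_ _ + _]; exact. Qed.

(** Take the characteristic of the CDF equation that ends at (u, X t1).  Its
projection to space is a space characteristic through X t1, because the velocity
does not see the state; by uniqueness it starts at t0 and coincides with X. *)
Lemma cdf_characteristic_above (u : R) : exists c : R -> R * 'rV[R]_d,
  [/\ cdf_characteristic Omega Gamma qdot r t0 t1 c, (c t1).1 = u &
      forall t, t \in `[t0, t1] -> (c t).2 = X t].
Proof.
have [s0 [c [charc ct1]]] :=
  one_cdf_curve.1 (u, X t1) t1 (X_spacetime t1I).
have charc2 : space_characteristic Omega Gamma a s0 t1 (fun t => (c t).2).
  case: charc => pathc odec _; split => //.
  apply: solves_ode_eq odec => // t tI /=.
  by apply: qdotE; case: pathc => _ _; apply; exact: subset_itv_oo_cc.
have s01 : s0 <= t1 by case: charc => -[].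
have s1I : t1 \in `[s0, t1] by rewrite in_itv/= s01 lexx.
have [es cX] : s0 = t0 /\ _ := one_space_curve.2 _ _ _ _ _ _ t1 charc2 charX
  s1I t1I (congr1 snd ct1).
by rewrite es in charc cX; exists c; split => //; [rewrite ct1 | move=> t tI; exact: cX].
Qed.

Lemma cdf_characteristic_above_ode (c : R -> R * 'rV[R]_d) :
  cdf_characteristic Omega Gamma qdot r t0 t1 c ->
  (forall t, t \in `[t0, t1] -> (c t).2 = X t) ->
  solves_ode t0 t1 ((fun t => (c t).1) : R -> R^o)
    (fun t => (c t).1 * k (X t) t + b (X t) t).
Proof.
move=> [_ _ odec] cX; apply: solves_ode_eq odec => // t /subset_itv_oo_cc tI.
by rewrite cX// rE//; exact: X_spacetime.
Qed.

(** D is the difference of the characteristics ending at the states 1 and 0, and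
B is the one ending at 0.  The label u is the state at the final time t1. *)
Lemma affine_cdf_flow : exists D B : R -> R,
  [/\ forall t, t \in `[t0, t1] -> 0 < D t,
      solves_ode t0 t1 (D : R -> R^o) (fun t => k (X t) t * D t) &
      forall u, exists c : R -> R * 'rV[R]_d,
        cdf_characteristic Omega Gamma qdot r t0 t1 c /\
        forall t, t \in `[t0, t1] -> c t = (B t + D t * u, X t)].
Proof.
have [c0 [char0 c0t1 c0X]] := cdf_characteristic_above 0.
have ode0 := cdf_characteristic_above_ode char0 c0X.
have odeB c : cdf_characteristic Omega Gamma qdot r t0 t1 c ->
    (forall t, t \in `[t0, t1] -> (c t).2 = X t) ->
    solves_ode t0 t1 ((fun t => (c t).1 - (c0 t).1) : R -> R^o)
      (fun t => k (X t) t * ((c t).1 - (c0 t).1)).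
  move=> charc cX.
  have := solves_odeB (cdf_characteristic_above_ode charc cX) ode0.
  by apply: solves_ode_eq => // t _ /=; ring.
have [c1 [char1 c1t1 c1X]] := cdf_characteristic_above 1.
pose D t := (c1 t).1 - (c0 t).1.
have Dt1 : D t1 = 1 by rewrite /D c1t1 c0t1 subr0.
have odeD := odeB c1 char1 c1X.
(* a zero of D would be a meeting point of two characteristics, which would then
   agree at t1 as well, against D t1 = 1 *)
have D0 t : t \in `[t0, t1] -> D t != 0.
  move=> tI; apply/eqP => /eqP; rewrite subr_eq0 => /eqP c10.
  have c1c0 : c1 t = c0 t by apply: injective_projections; rewrite ?c1X ?c0X.
  have [_ /(_ t1 t1I t1I) e] := one_cdf_curve.2 _ _ _ _ _ _ t char1 char0 tI tI c1c0.
  by move: Dt1; rewrite /D e subrr => /esym/eqP; rewrite oner_eq0.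
exists D, (fun t => (c0 t).1); split=> //.
- by apply: (@nonvanishing_gt0 R t0 t1 D odeD.1 D0); rewrite Dt1.
- move=> u; have [c [charc ct1 cX]] := cdf_characteristic_above u.
  exists c; split=> // t tI; rewrite [LHS]surjective_pairing cX//; congr pair.
  have := linear_ode_proportional D0 odeD (odeB c charc cX) tI.
  by rewrite Dt1 ct1 c0t1 subr0 divr1 (mulrC (D t)) => <-; rewrite addrC subrK.
Qed.

Lemma cdf_solution_along (F : 'rV[R]_d -> R -> R -> R) F0 Fb (B D : R -> R) :
  cdf_solution Omega Gamma qdot r F0 Fb F ->
  (forall u, exists c : R -> R * 'rV[R]_d,
        cdf_characteristic Omega Gamma qdot r t0 t1 c /\
        forall t, t \in `[t0, t1] -> c t = (B t + D t * u, X t)) ->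
  forall t, t \in `[t0, t1] ->
  (fun u => F (X t) t (B t + D t * u)) =
  (fun u => F (X t0) t0 (B t0 + D t0 * u)).
Proof.
move=> [Fchar _ _] flow t tI; apply/funext => u.
have [c [charc cE]] := flow u.
by have := Fchar _ _ _ charc _ tI; rewrite !cE.
Qed.

Lemma wasserstein1_growth (F1 F2 : 'rV[R]_d -> R -> R -> R) F01 F02 Fb1 Fb2 :
  (forall x t, spacetime Omega Gamma x t -> cdf_finite_mean (F1 x t)) ->
  (forall x t, spacetime Omega Gamma x t -> cdf_finite_mean (F2 x t)) ->
  cdf_solution Omega Gamma qdot r F01 Fb1 F1 ->
  cdf_solution Omega Gamma qdot r F02 Fb2 F2 ->
  solves_ode t0 t1
    ((fun t => wasserstein1 (F1 (X t) t) (F2 (X t) t)) : R -> R^o)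
    (fun t => k (X t) t * wasserstein1 (F1 (X t) t) (F2 (X t) t)).
Proof.
move=> cdf1 cdf2 sol1 sol2.
have [D [B [D0 odeD flow]]] := affine_cdf_flow.
(* the discrepancy at the inflow point, measured in the coordinate u *)
pose C := wasserstein1 (fun u => F1 (X t0) t0 (B t0 + D t0 * u))
                       (fun u => F2 (X t0) t0 (B t0 + D t0 * u)).
have WE t : t \in `[t0, t1] ->
    wasserstein1 (F1 (X t) t) (F2 (X t) t) = C * D t.
  move=> tI; have xt := X_spacetime tI.
  rewrite (wasserstein1_affine (B t) (D0 t tI) (cdf1 _ _ xt) (cdf2 _ _ xt)).
  by rewrite (cdf_solution_along sol1 flow tI) (cdf_solution_along sol2 flow tI) mulrC.
have := solves_odeZ C odeD.
apply: solves_ode_eq => t tI; rewrite WE//; last exact: subset_itv_oo_cc.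
by rewrite /GRing.scale/= mulrCA.
Qed.

End linear_characteristics.

Theorem theorem5p4 (R : realType) (d : nat) (Omega Gamma : set 'rV[R]_d)
  (hOmega : semi_infinite_domain Omega Gamma)
  (Tq Tr : Type)
  (q : R -> Tq -> 'rV[R]_d) (r : R -> Tr -> R)
  (thq : 'rV[R]_d -> R -> Tq) (thr : 'rV[R]_d -> R -> Tr)
  (hdiv : forall (U : R) (x : 'rV[R]_d) (t : R), interior Omega x -> 0 < t ->
     divergence_free_at (fun y => q U (thq y t)) x)
  (hqlin : forall (x : 'rV[R]_d) (t : R), spacetime Omega Gamma x t ->
     linear_in_state (q ^~ (thq x t)))
  (hrlin : forall (x : 'rV[R]_d) (t : R), spacetime Omega Gamma x t ->
     linear_in_state ((r ^~ (thr x t)) : R -> R^o))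
  (hchar_cdf : one_curve_through_each_point
     (fun (p : R * 'rV[R]_d) (t : R) => spacetime Omega Gamma p.2 t)
     (cdf_characteristic Omega Gamma
       (state_derivative q thq) (fun U x t => r U (thr x t))))
  (hchar_space : forall V : R, one_curve_through_each_point
     (spacetime Omega Gamma)
     (space_characteristic Omega Gamma (state_derivative q thq V)))
  (F1 F2 : 'rV[R]_d -> R -> R -> R)
  (F01 F02 : 'rV[R]_d -> R -> R) (Fb1 Fb2 : 'rV[R]_d -> R -> R -> R)
  (hF1 : forall (x : 'rV[R]_d) (t : R), spacetime Omega Gamma x t ->
     cdf_finite_mean (F1 x t))
  (hF2 : forall (x : 'rV[R]_d) (t : R), spacetime Omega Gamma x t ->
     cdf_finite_mean (F2 x t))
  (hsol1 : cdf_solution Omega Gamma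
       (state_derivative q thq) (fun U x t => r U (thr x t)) F01 Fb1 F1)
  (hsol2 : cdf_solution Omega Gamma
       (state_derivative q thq) (fun U x t => r U (thr x t)) F02 Fb2 F2) :
  (* the state derivatives do not depend on the state V *)
  forall V : R,
  growth_solution Omega Gamma (state_derivative q thq V) 
    (state_derivative (r : R -> Tr -> R^o) thr V)
    (fun x => wasserstein1 (F01 x) (F02 x))
    (fun x t => wasserstein1 (Fb1 x t) (Fb2 x t))
    (fun x t => wasserstein1 (F1 x t) (F2 x t)).
Proof.
move=> V.
have qE x t : spacetime Omega Gamma x t -> forall U,
    state_derivative q thq U x t = state_derivative q thq V x t.
  move=> xt U.
  have [b qE] := @linear_state_derivative _ _ _ _ q thq _ _ (hqlin _ _ xt).
  by have := qE U 1; rewrite (qE V) !scale1r => /addIr.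
(* the affine part of the source is its value at the state 0 *)
pose b x t := r 0 (thr x t).
have rE x t : spacetime Omega Gamma x t -> forall U,
    r U (thr x t) = U * state_derivative (r : R -> Tr -> R^o) thr V x t + b x t.
  move=> xt U.
  have [b' bE] :=
    @linear_state_derivative _ _ _ _ (r : R -> Tr -> R^o) thr _ _ (hrlin _ _ xt).
  by rewrite /b !(bE V) scale0r add0r.
split.
- move=> t0 t1 X charX.
  exact: (wasserstein1_growth qE rE hchar_cdf (hchar_space V) charX
    hF1 hF2 hsol1 hsol2).
- move=> x Ox; case: hsol1 hsol2 => _ ini1 _ [_ ini2 _].
  by apply: eq_Rintegral => U _; rewrite ini1// ini2.
- move=> x t Gx t_gt0; case: hsol1 hsol2 => _ _ bnd1 [_ _ bnd2].
  by apply: eq_Rintegral => U _; rewrite bnd1// bnd2.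
Qed.
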